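(* Let $A$ and $B$ be respectively $m\times m$ and $n\times n$ irreducible matrices over $\mathbb{R}$. If $A$ and $B$ are ESSE$-\mathbb{R}_+$, then $\mathcal{S}(A)$ and $\mathcal{S}(B)$ are also ESSE$-\mathbb{R}_+$. Moreover, there exist generalized row stochastic matrices $R,S$ such that $\mathcal{S}(A)=RS$ and $\mathcal{S}(B)=SR$.
   Context: A square matrix $A$ is irreducible if it is nonnegative (all entries $\ge 0$) and for any $(i,j)$ there is some $k\in\mathbb{N}$ (positive integer) with $(A^k)_{ij}>0$. For an irreducible matrix $A$ with spectral radius $\lambda$, the stochasticization of $A$ is the stochastic matrix $\mathcal{S}(A)=\frac1\lambda D^{-1}AD$, where $D$ is the diagonal matrix whose vector of diagonal entries is the (positive, unique up to scaling) right eigenvector of $A$ corresponding to the eigenvalue $\lambda$. A (not necessarily square) matrix is generalized row stochastic if it is nonnegative and every row sum is $1$. $\mathbb{R}_+$ is the semiring of nonnegative real numbers. Square matrices $A,B$ over $\mathbb{R}_+$ (possibly of different sizes) are elementary strong shift equivalent over $\mathbb{R}_+$ (ESSE$-\mathbb{R}_+$) if there exist (possibly rectangular) matrices $U,V$ over $\mathbb{R}_+$ with $A=UV$, $B=VU$. *)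

(* Defs.v *)
From HB Require Import structures.
From mathcomp Require Import all_boot all_order all_algebra.
From mathcomp Require Import complex.
From mathcomp Require Import boolp classical_sets reals.

Set Implicit Arguments.
Unset Strict Implicit.
Unset Printing Implicit Defensive.

Import Order.TTheory GRing.Theory Num.Theory.
Local Open Scope classical_set_scope.
Local Open Scope ring_scope.

Definition irreducible_mx (R : realType) (n : nat) (A : 'M[R]_n) : Prop :=
  A \is a mxOver Num.nneg /\
  forall i j : 'I_n, exists k : nat, (0 < k)%N /\ 0 < (A ^+ k) i j.

(* The supremum is a maximum as soon as 0 < n: there are finitely many complex
   eigenvalues, and at least one.  [eigenvalue] is stated with row vectors,
   which gives the same set of eigenvalues as column vectors. *)
Definition spectral_radius (R : realType) (n : nat) (A : 'M[R]_n) : R :=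
  sup [set ComplexField.Normc.normc z
      | z in [set z : R[i] | eigenvalue (map_mx (real_complex R) A) z]].

Definition is_perron_vector (R : realType) (n : nat) (A : 'M[R]_n)
    (r : 'cV[R]_n) : Prop :=
  (forall i, 0 < r i 0) /\ A *m r = spectral_radius A *: r.

(* For irreducible [A] a Perron vector exists and is unique up to scaling, and
   [stochasticization A] does not depend on the scaling, so any choice will do.
   The default value 0 is only reached when there is no Perron vector. *)
Definition perron_vector (R : realType) (n : nat) (A : 'M[R]_n) : 'cV[R]_n :=
  xget 0 [set r | is_perron_vector A r].

Definition stochasticization (R : realType) (n : nat) (A : 'M[R]_n) : 'M[R]_n :=
  let D := diag_mx (perron_vector A)^T in
  (spectral_radius A)^-1 *: (invmx D *m A *m D).

Definition generalized_row_stochastic (R : realType) (m n : nat)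
    (M : 'M[R]_(m, n)) : Prop :=
  M \is a mxOver Num.nneg /\ forall i : 'I_m, \sum_(j < n) M i j = 1.

Definition ESSE_nneg (R : realType) (m n : nat)
    (A : 'M[R]_m) (B : 'M[R]_n) : Prop :=
  exists (U : 'M[R]_(m, n)) (V : 'M[R]_(n, m)),
    [/\ U \is a mxOver Num.nneg, V \is a mxOver Num.nneg,
        A = U *m V & B = V *m U].

(* Main.v *)
Require Import Defs.
From HB Require Import structures.
From mathcomp Require Import all_boot all_order all_algebra.
From mathcomp Require Import complex.
From mathcomp Require Import boolp classical_sets reals.
From mathcomp Require Import topology normedtype derive.

(** Let [r], [s] be the Perron vectors of [A = U V] and [B = V U], and [t] the
    spectral radius of [A]. Since [B (V r) = V (A r) = t (V r)] and [V r] is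
    nonnegative and nonzero, it is a positive eigenvector of [B]; hence [t] is
    also the spectral radius of [B] and [s = c V r] for some [c > 0], so that
    [U s = c t r]. The matrices [(c t)^-1 D_r^-1 U D_s] and [c D_s^-1 V D_r]
    therefore have row sums 1, and their two products are the
    stochasticizations of [A] and [B].

    The Perron vector of an irreducible matrix comes from maximising, by
    compactness, the [t] such that [x A >= t x] for some nonzero [x >= 0]. *)

Set Implicit Arguments.
Unset Strict Implicit.
Unset Printing Implicit Defensive.

Import Order.TTheory GRing.Theory Num.Theory.
Import numFieldNormedType.Exports.
Local Open Scope ring_scope.

(** * Positivity and uniqueness of eigenvectors of irreducible matrices *)

(** The index minimising [u i / v i] gives the largest multiple of [v] below [u], with equality at
    that index. *)
Lemma min_ratio (R : realFieldType) n (u v : 'I_n.+1 -> R) :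
  (forall i, 0 < v i) -> exists i, forall j, u i / v i * v j <= u j.
Proof.
move=> v0; case: (arg_minP (fun i => u i / v i) (isT : xpredT (ord0 : 'I_n.+1))).
by move=> i _ min_i; exists i => j; rewrite -ler_pdivlMr// min_i.
Qed.

Lemma mulmx_col_gt0 (R : numDomainType) m n (P : 'M[R]_(m, n)) (x : 'cV[R]_n) :
  (forall i j, 0 < P i j) -> (forall j, 0 <= x j 0) -> x != 0 ->
  forall i, 0 < (P *m x) i 0.
Proof.
move=> P0 x0 /eqP xN0 i; rewrite lt0r mxE sumr_ge0 ?andbT; last first.
  by move=> j _; rewrite mulr_ge0 // ltW.
apply/negP; rewrite psumr_eq0 => [/allP xz|j _]; last by rewrite mulr_ge0 // ltW.
apply: xN0; apply/matrixP => j k; rewrite ord1 mxE.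
have := xz j (mem_index_enum j).
by rewrite /= mulf_eq0 (gt_eqF (P0 i j)) => /eqP.
Qed.

Lemma mxOver_exp_nneg (R : numDomainType) n (A : 'M[R]_n) k :
  A \is a mxOver Num.nneg -> A ^+ k \is a mxOver Num.nneg.
Proof.
move=> A0; elim: k => [|k IHk]; last by rewrite exprS mxOverM.
apply/mxOverP => i j; rewrite expr0 mxE.
by case: (i == j); rewrite /= ?mulr1n ?mulr0n ?rpred0 ?rpred1.
Qed.

Lemma exp_mx_eigen (R : comPzRingType) n (A : 'M[R]_n) (x : 'cV[R]_n) t k :
  A *m x = t *: x -> A ^+ k *m x = t ^+ k *: x.
Proof.
move=> Ax; elim: k => [|k IHk]; first by rewrite !expr0 mul1mx scale1r.
by rewrite exprSr exprS -[_ * A]/(_ *m A) -mulmxA Ax -scalemxAr IHk scalerA.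
Qed.

(* Summing one power of [A] witnessing irreducibility per entry gives an
   entrywise positive polynomial in [A]. *)
Lemma irreducible_positive_polynomial (R : realType) n (A : 'M[R]_n) :
  irreducible_mx A ->
  exists P : 'M[R]_n, [/\ forall i j, 0 < P i j, P *m A = A *m P &
    forall (x : 'cV_n) t, A *m x = t *: x -> exists s, P *m x = s *: x].
Proof.
case=> A0 /(_ _ _)/cid irr.
pose k i j := sval (irr i j).
exists (\sum_i \sum_j A ^+ k i j); split => [i j||x t Ax].
- have ge0 a b : 0 <= (A ^+ k a b) i j.
    by have /mxOverP/(_ i j) := mxOver_exp_nneg (k a b) A0.
  rewrite (bigD1 i)//= (bigD1 j)//= !mxE.
  rewrite -addrA ltr_pwDl//; first by have [_] := svalP (irr i j).
  rewrite !summxE addr_ge0// sumr_ge0// => a _; rewrite summxE sumr_ge0//.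
- rewrite mulmx_suml mulmx_sumr; apply: eq_bigr => i _.
  rewrite mulmx_suml mulmx_sumr; apply: eq_bigr => j _.
  by rewrite -[LHS]exprSr -[RHS]exprS.
- exists (\sum_i \sum_j t ^+ k i j).
  rewrite mulmx_suml scaler_suml; apply: eq_bigr => i _.
  rewrite mulmx_suml scaler_suml; apply: eq_bigr => j _.
  exact: exp_mx_eigen.
Qed.

(** A positive polynomial [P] in [A] makes [P *m x] entrywise positive, yet [P *m x] is a multiple
    of [x], so no entry of [x] can vanish. *)
Lemma nneg_eigenvector_gt0 (R : realType) n (A : 'M[R]_n) (x : 'cV[R]_n) t :
  irreducible_mx A -> (forall i, 0 <= x i 0) -> x != 0 -> A *m x = t *: x ->
  forall i, 0 < x i 0.
Proof.
move=> /irreducible_positive_polynomial[P [P0 _ Peig]] x0 xN0 Ax i.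
have [s Px] := Peig _ _ Ax.
have := mulmx_col_gt0 P0 x0 xN0 i; rewrite Px mxE => sx.
by rewrite lt0r x0 andbT; apply: contraTneq sx => ->; rewrite mulr0 ltxx.
Qed.

(** Subtracting from [y] the largest multiple of [x] below it leaves a nonnegative eigenvector with
    a zero entry; by [nneg_eigenvector_gt0] it is zero. *)
Lemma positive_eigenvector_unique (R : realType) n (A : 'M[R]_n)
    (x y : 'cV[R]_n) t :
  irreducible_mx A -> (forall i, 0 < x i 0) -> (forall i, 0 < y i 0) ->
  A *m x = t *: x -> A *m y = t *: y -> exists2 c, 0 < c & y = c *: x.
Proof.
case: n A x y => [|n] A x y irrA x0 y0 Ax Ay.
  by exists 1 => //; rewrite (flatmx0 y) (flatmx0 (_ *: _)).
have [i min_i] := min_ratio (fun i => y i 0) x0.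
pose c := y i 0 / x i 0; exists c; first by rewrite divr_gt0.
apply/eqP; rewrite -subr_eq0; apply/negPn/negP => zN0.
have : 0 < (y - c *: x) i 0.
  apply: (nneg_eigenvector_gt0 (t := t) irrA _ zN0) => [j|].
    by rewrite !mxE subr_ge0 min_i.
  by rewrite mulmxBr Ay -scalemxAr Ax scalerBr !scalerA mulrC.
by rewrite !mxE divfK ?gt_eqF// subrr ltxx.
Qed.

Lemma positive_eigenvalue_gt0 (R : realType) n (A : 'M[R]_n) (x : 'cV[R]_n) t :
  (0 < n)%N -> irreducible_mx A -> (forall i, 0 < x i 0) -> A *m x = t *: x ->
  0 < t.
Proof.
case: n A x => // n A x _ [A0 irr] x0 Ax.
have t0 : 0 <= t.
  rewrite -(pmulr_lge0 _ (x0 0)).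
  have -> : t * x 0 0 = (A *m x) 0 0 by rewrite Ax mxE.
  rewrite mxE sumr_ge0// => j _.
  by rewrite mulr_ge0 ?(ltW (x0 j))//; exact: (mxOverP A0).
(* If [t] were 0, every positive power of [A] would kill the positive vector [x], but some such
   power has a positive corner entry. *)
rewrite lt0r t0 andbT; apply/eqP => tz.
have [k [k0 Ak]] := irr 0 0.
have /matrixP/(_ 0 0) := exp_mx_eigen k Ax.
rewrite tz expr0n gtn_eqF//= scale0r !mxE => /eqP.
have ge0 j : 0 <= (A ^+ k) 0 j * x j 0.
  have /mxOverP/(_ 0 j) := mxOver_exp_nneg k A0.
  by move=> a0; rewrite mulr_ge0// ltW.
by rewrite psumr_eq0// => /allP/(_ 0 (mem_index_enum _)); rewrite /= gt_eqF// mulr_gt0.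
Qed.

(** * The spectral radius as the eigenvalue of a positive eigenvector *)

Lemma normc_real (R : rcfType) (x : R) :
  0 <= x -> ComplexField.Normc.normc (real_complex R x) = x.
Proof. by move=> x0; rewrite /= expr0n addr0 sqrtr_sqr ger0_norm. Qed.

Lemma ler_normc_sum (R : rcfType) (I : Type) (r : seq I) (F : I -> R[i]) :
  ComplexField.Normc.normc (\sum_(i <- r) F i)
    <= \sum_(i <- r) ComplexField.Normc.normc (F i).
Proof.
elim/big_rec2: _ => [|i y z _ le]; first by rewrite ComplexField.Normc.normc0.
by rewrite (le_trans (le_normcD _ _))// lerD2l.
Qed.

(* The weighted l1 norm with weights [x] is multiplied by at most [t] under
   right multiplication by [A]. *)
Lemma spectral_radius_positive_eigenvector (R : realType) n (A : 'M[R]_n)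
    (x : 'cV[R]_n) t :
  (0 < n)%N -> A \is a mxOver Num.nneg -> (forall i, 0 < x i 0) -> A *m x = t *: x ->
  0 <= t -> spectral_radius A = t.
Proof.
move=> n0 /mxOverP A0 x0 Ax t0; pose N := @ComplexField.Normc.normc R.
have N0 z : 0 <= N z by case: z => a b; rewrite /N /= sqrtr_ge0.
(* [eigenvalue] concerns row vectors and [x] is a column; both sides are linked by the singularity
   of [A - t%:M]. *)
have eig_t : eigenvalue A t.
  rewrite /eigenvalue kermx_eq0 row_free_unit; apply/negP => Au.
  have : x = 0.
    apply: (can_inj (mulKmx Au)); rewrite mulmx0 mulmxBl Ax.
    by rewrite mul_scalar_mx subrr.
  by move=> xz; have := x0 (Ordinal n0); rewrite xz mxE ltxx.
have ub z : eigenvalue (map_mx (real_complex R) A) z -> N z <= t.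
  move=> /eigenvalueP[v vA vN0].
  have w0 : 0 < \sum_j N (v 0 j) * x j 0.
    have [j vj] : exists j, v 0 j != 0.
      apply/existsP; apply: contraNT vN0 => /existsPn vz.
      apply/eqP/matrixP => i j; rewrite ord1 mxE.
      by have /negPn/eqP := vz j.
    rewrite (bigD1 j)//= ltr_pwDl//.
      rewrite mulr_gt0// lt0r N0 andbT.
      by apply: contraNneq vj => /ComplexField.Normc.eq0_normc ->.
    by apply: sumr_ge0 => k _; rewrite mulr_ge0// ltW.
  rewrite -(ler_pM2r w0) mulr_sumr.
  have -> : t * (\sum_j N (v 0 j) * x j 0)
      = \sum_j (\sum_i N (v 0 i) * A i j) * x j 0.
    rewrite mulr_sumr; under [RHS]eq_bigr do rewrite mulr_suml.
    rewrite exchange_big /=; apply: eq_bigr => i _.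
    under eq_bigr do rewrite -mulrA.
    rewrite -mulr_sumr mulrCA; congr (_ * _).
    by have /matrixP/(_ i 0) := Ax; rewrite !mxE => ->.
  apply: ler_sum => j _; rewrite mulrA ler_pM2r//.
  rewrite -ComplexField.Normc.normcM.
  have /matrixP/(_ 0 j) := vA; rewrite !mxE => <-.
  apply: (le_trans (ler_normc_sum _ _)); apply: ler_sum => i _.
  by rewrite ComplexField.Normc.normcM mxE [X in _ * X]normc_real//; exact: A0.
have mem : [set ComplexField.Normc.normc z | z in
    [set z : R[i] | eigenvalue (map_mx (real_complex R) A) z]]%classic t.
  by exists (real_complex R t); rewrite ?normc_real//= eigenvalue_map.
apply/eqP; rewrite eq_le; apply/andP; split.
  by apply: ge_sup; [exists t | move=> _ [z /= /ub + <-]].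
by apply: ub_le_sup => //; exists t => _ [z /= /ub + <-].
Qed.

(** * Existence of the Perron vector by maximisation *)

(** The constraint is invariant under positive scaling of [x], so [x] may be normalised to total
    mass 1; the admissible pairs [(x, t)] with [t >= 0] then form a compact set, on which [t]
    attains its maximum. *)
Lemma collatz_wielandt (R : realType) n (A : 'M[R]_n.+1) :
  A \is a mxOver Num.nneg ->
  exists (t : R) (x : 'rV[R]_n.+1),
    [/\ 0 <= t, x != 0, forall i, 0 <= x 0 i,
        forall j, t * x 0 j <= (x *m A) 0 j &
        forall (s : R) (y : 'rV[R]_n.+1), y != 0 -> (forall i, 0 <= y 0 i) ->
          (forall j, s * y 0 j <= (y *m A) 0 j) -> s <= t].
Proof.
(* [M] bounds every admissible [t]: sum the inequalities over [j] and use that the entries of [x]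
   are at most 1 and add up to 1. *)
move=> /mxOverP A0; pose M := \sum_j \sum_i A i j.
have M0 : 0 <= M.
  by apply: sumr_ge0 => j _; apply: sumr_ge0 => i _; exact: A0.
pose box : set ('rV[R]_n.+1 * R) :=
  ([set v : 'rV[R]_n.+1 | forall i, v ord0 i \in `[0, 1]%R] `*` `[0, M])%classic.
pose lhs j (p : 'rV[R]_n.+1 * R) := (p.1 *m A) 0 j - p.2 * p.1 0 j.
pose mass (p : 'rV[R]_n.+1 * R) := \sum_i p.1 0 i.
(* Fixing [mass] to 1 excludes the zero vector by a closed condition. *)
pose K : set ('rV[R]_n.+1 * R) :=
  (box `&` (mass @^-1` [set x | x = 1]
    `&` \bigcap_j (lhs j @^-1` [set x | 0 <= x])))%classic.
have coordC i : continuous (fun p : 'rV[R]_n.+1 * R => p.1 0 i).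
  move=> p; apply: (@continuous_comp _ _ _ fst (fun v : 'rV[R]_n.+1 => v 0 i)).
    exact: cvg_fst.
  exact: coord_continuous.
have massC : continuous mass.
  apply: (@continuous_big R _ +%R 0) => [|i _]; first exact: add_continuous.
  exact: coordC.
have lhsC j : continuous (lhs j).
  move=> p; apply: cvgB; last by apply: cvgM; [exact: cvg_snd|exact: coordC].
  rewrite /lhs; under eq_fun do rewrite mxE.
  rewrite mxE; apply: (@continuous_big R _ +%R 0) => [|i _].
    exact: add_continuous.
  by move=> q; apply: cvgM; [exact: coordC|exact: cvg_cst].
have box_compact : compact box.
  apply: compact_setX; last exact: segment_compact.
  have := @rV_compact R n.+1 (fun=> `[0, 1]%classic).
  by apply=> _; exact: segment_compact.
have cK : compact K.
  apply: (@subclosed_compact _ _ box) => //; last by move=> p [].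
  apply: closedI; last apply: closedI.
  - by apply: compact_closed => //; exact: norm_hausdorff.
  - by apply: (preimage_closed _ (@closed_eq _ _)) => p _; exact: massC.
  - apply: closed_bigI => j _.
    by apply: (preimage_closed _ (@closed_ge _ _)) => p _; exact: lhsC.
have KP (s : R) (y : 'rV[R]_n.+1) : 0 <= s -> \sum_i y 0 i = 1 ->
    (forall i, 0 <= y 0 i) -> (forall j, s * y 0 j <= (y *m A) 0 j) -> K (y, s).
  move=> s0 y1 y0 sy.
  have yle1 i : y 0 i <= 1.
    by rewrite -y1 (bigD1 i)//= lerDl sumr_ge0.
  split; last first.
    by split => //= j _; rewrite /lhs /= subr_ge0.
  split => /=; first by move=> i; rewrite in_itv /= y0 yle1.
  rewrite in_itv /= s0 /= -[s]mulr1 -y1 mulr_sumr.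
  apply: ler_sum => j _; apply: (le_trans (sy j)); rewrite mxE.
  by apply: ler_sum => i _; rewrite ler_piMl//; exact: A0.
have normalized (s : R) (y : 'rV[R]_n.+1) : 0 <= s -> y != 0 ->
    (forall i, 0 <= y 0 i) -> (forall j, s * y 0 j <= (y *m A) 0 j) ->
    exists z, K (z, s).
  move=> s0 yN0 y0 sy; pose c := \sum_i y 0 i.
  have c0 : 0 < c.
    rewrite lt0r sumr_ge0 // andbT; apply: contra yN0.
    rewrite psumr_eq0// => /allP yz; apply/eqP/matrixP => i j.
    by rewrite ord1 mxE; apply/eqP/yz/mem_index_enum.
  exists (c^-1 *: y); apply: KP => //.
  - by under eq_bigr do rewrite mxE; rewrite -mulr_sumr mulVf// gt_eqF.
  - by move=> i; rewrite mxE mulr_ge0// invr_ge0 ltW.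
  - by move=> j; rewrite -scalemxAl [leRHS]mxE mxE mulrCA ler_pM2l ?invr_gt0.
(* For [t = 0] the inequalities only ask that [x *m A] be nonnegative, so a constant vector will
   do. *)
have K_neq0 : (K !=set0)%classic.
  have [||||z Kz] := @normalized 0 (const_mx 1) => //.
  - by apply/eqP => /matrixP/(_ 0 0)/eqP; rewrite !mxE oner_eq0.
  - by move=> i; rewrite mxE.
  - by move=> j; rewrite mul0r mxE sumr_ge0// => i _; rewrite mxE mul1r; exact: A0.
  - by exists (z, 0).
have [|[x t]] := @compact_EVT_max _ R snd K K_neq0 cK.
  by apply: continuous_subspaceT => p; exact: cvg_snd.
rewrite inE => -[[/= x01 t0M] [/= x1 tx]] max_t.
have t0 : 0 <= t by move: t0M; rewrite in_itv => /andP[].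
exists t, x; split => //.
- apply/eqP => xz; move: x1; rewrite /mass xz /=.
  rewrite big1 => [/eqP|i _]; last by rewrite mxE.
  by rewrite eq_sym oner_eq0.
- by move=> i; have := x01 i; rewrite in_itv => /andP[].
- by move=> j; have := tx j I; rewrite /lhs /= subr_ge0.
- move=> s y yN0 y0 sy; have [s0|/ltW s0] := leP 0 s; last exact: le_trans t0.
  have [z Kz] := normalized s y s0 yN0 y0 sy.
  by have /= := max_t (z, s) (mem_set Kz).
Qed.

(* If the maximiser [x] of the Collatz-Wielandt problem for [A^T] were not an
   eigenvector, applying a positive matrix commuting with [A] would make
   [A *m x >= t *: x] strict in every entry, contradicting maximality. *)
Lemma irreducible_positive_eigenvector (R : realType) n (A : 'M[R]_n.+1) :
  irreducible_mx A ->
  exists (t : R) (x : 'cV[R]_n.+1), (forall i, 0 < x i 0) /\ A *m x = t *: x.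
Proof.
move=> irrA; have [A0 _] := irrA.
have AT0 : A^T \is a mxOver Num.nneg.
  by apply/mxOverP => i j; rewrite mxE; exact: (mxOverP A0).
have [t [w [t0 wN0 w0 tw max_t]]] := collatz_wielandt AT0.
pose x := w^T; have x0 i : 0 <= x i 0 by rewrite mxE.
have xN0 : x != 0.
  by apply: contra wN0 => /eqP xz; rewrite -(trmxK w) -/x xz trmx0.
have mulT (y : 'cV[R]_n.+1) j : (y^T *m A^T) 0 j = (A *m y) j 0.
  by rewrite -trmx_mul mxE.
suff Ax : A *m x = t *: x.
  by exists t, x; split => //; exact: nneg_eigenvector_gt0 Ax.
apply/eqP; rewrite -subr_eq0; apply/negPn/negP => zN0.
set z := A *m x - t *: x in zN0.
have z0 i : 0 <= z i 0.
  by rewrite mxE -mulT trmxK [X in _ + X]mxE [X in - X]mxE subr_ge0 [X in _ * X]mxE tw.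
have [P [P0 PA _]] := irreducible_positive_polynomial irrA.
have y0 := mulmx_col_gt0 P0 x0 xN0; have Pz0 := mulmx_col_gt0 P0 z0 zN0.
set y := P *m x in y0.
have [i min_i] := min_ratio (fun i => (P *m z) i 0) y0.
(* Since [P] commutes with [A], [P *m z] is the excess of [A *m y] over [t *: y]; [e] is its least
   ratio to [y], so [t + e] is admissible for [y]. *)
pose e := (P *m z) i 0 / y i 0.
have e0 : 0 < e by rewrite divr_gt0.
have Pz : P *m z = A *m y - t *: y.
  by rewrite mulmxBr !mulmxA PA scalemxAr.
have /negP[] : ~~ (t + e <= t) by rewrite -ltNge ltrDl.
apply: (max_t _ y^T) => [|j|j].
- by apply: contraTneq (y0 0) => yz; rewrite -(trmxK y) yz trmx0 mxE ltxx.
- by rewrite mxE ltW.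
- rewrite mulT mxE mulrDl -lerBrDl.
  by have := min_i j; rewrite -/e Pz [X in _ <= X -> _]mxE [X in _ + X]mxE [X in _ - X]mxE.
Qed.

(** The eigenvalue of any positive eigenvector is the spectral radius, so such an eigenvector is a
    Perron vector and [xget] does not fall back on its default. *)
Lemma perron_vectorP (R : realType) n (A : 'M[R]_n) :
  (0 < n)%N -> irreducible_mx A ->
  is_perron_vector A (perron_vector A) /\ 0 < spectral_radius A.
Proof.
case: n A => // n A n0 irrA.
have [t [x [x0 Ax]]] := irreducible_positive_eigenvector irrA.
have t0 := positive_eigenvalue_gt0 n0 irrA x0 Ax.
have tE := spectral_radius_positive_eigenvector n0 irrA.1 x0 Ax (ltW t0).
rewrite tE; split => //; apply: xgetPex.
by exists x; split; rewrite ?tE.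
Qed.

(** * Diagonal scaling and the stochastic factorization *)

Lemma diag_mx_unitmx (F : fieldType) n (d : 'rV[F]_n) :
  (forall i, d 0 i != 0) ->
  diag_mx d \in unitmx /\ invmx (diag_mx d) = diag_mx (\row_i (d 0 i)^-1).
Proof.
move=> d0.
have dV : diag_mx (\row_i (d 0 i)^-1) *m diag_mx d = 1%:M.
  rewrite mulmx_diag -diag_const_mx; congr diag_mx.
  by apply/rowP => i; rewrite !mxE mulVf.
have [_ du] := mulmx1_unit dV; split => //.
by rewrite -[LHS]mul1mx -dV mulmxK.
Qed.

Lemma irreducible_mx0 (R : realType) n : irreducible_mx (0 : 'M[R]_n) -> n = 0.
Proof.
case: n => // n [_ /(_ 0 0)[[|k] [//]]].
by rewrite exprS [_ * _]mul0mx mxE ltxx.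
Qed.

Theorem theorem5p3 (R : realType) (m n : nat) (A : 'M[R]_m) (B : 'M[R]_n)
    (irrA : irreducible_mx A) (irrB : irreducible_mx B)
    (esseAB : ESSE_nneg A B) :
  ESSE_nneg (stochasticization A) (stochasticization B) /\
  exists (P : 'M[R]_(m, n)) (Q : 'M[R]_(n, m)),
    [/\ generalized_row_stochastic P, generalized_row_stochastic Q,
        stochasticization A = P *m Q & stochasticization B = Q *m P].
Proof.
(* Row stochastic factors are nonnegative, so they also witness the elementary equivalence. *)
suff: exists (P : 'M[R]_(m, n)) (Q : 'M[R]_(n, m)),
    [/\ generalized_row_stochastic P, generalized_row_stochastic Q,
        stochasticization A = P *m Q & stochasticization B = Q *m P].
  by move=> [P [Q [sP sQ PQ QP]]]; split; exists P, Q; case: sP sQ => ? ? [].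
case: esseAB => U [V [U0 V0 AE BE]].
(* If exactly one size is 0, the other matrix factors through an empty index set and is therefore
   zero, contradicting irreducibility. *)
have [m0|m_gt0] := posnP m; have [n0|n_gt0] := posnP n.
- subst m n; exists 0, 0; split; rewrite ?[LHS]flatmx0 ?[RHS]flatmx0//;
  by split; [apply/mxOverP|]; case.
- subst m; move: irrB; rewrite BE (thinmx0 V) mul0mx => /irreducible_mx0 nz.
  by rewrite nz in n_gt0.
- subst n; move: irrA; rewrite AE (thinmx0 U) mul0mx => /irreducible_mx0 mz.
  by rewrite mz in m_gt0.
have [[r0 Ar] t0] := perron_vectorP m_gt0 irrA.
have [[s0 Bs] _] := perron_vectorP n_gt0 irrB.
rewrite /stochasticization.
set r := perron_vector A in r0 Ar *; set s := perron_vector B in s0 Bs *.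
set t := spectral_radius A in Ar t0 *.
have UVr : U *m (V *m r) = t *: r by rewrite mulmxA -AE.
have BVr : B *m (V *m r) = t *: (V *m r).
  by rewrite BE -mulmxA UVr scalemxAr.
have Vr0 i : 0 <= (V *m r) i 0.
  rewrite mxE sumr_ge0// => j _.
  by rewrite mulr_ge0 ?(ltW (r0 j))//; exact: (mxOverP V0).
have VrN0 : V *m r != 0.
  apply/eqP => Vrz; move: UVr; rewrite Vrz mulmx0 => /matrixP/(_ (Ordinal m_gt0) 0).
  by rewrite !mxE => /esym/eqP; rewrite gt_eqF// mulr_gt0.
have Vr_gt0 := nneg_eigenvector_gt0 irrB Vr0 VrN0 BVr.
have tB : spectral_radius B = t.
  exact: (spectral_radius_positive_eigenvector n_gt0 irrB.1 Vr_gt0 BVr (ltW t0)).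
rewrite tB in Bs *.
have [c c0 sE] := positive_eigenvector_unique irrB Vr_gt0 s0 BVr Bs.
have Us : U *m s = (c * t) *: r by rewrite sE -scalemxAr UVr scalerA.
have rT i : r^T 0 i != 0 by rewrite mxE gt_eqF.
have sT i : s^T 0 i != 0 by rewrite mxE gt_eqF.
have [Dru DrV] := diag_mx_unitmx rT; have [Dsu DsV] := diag_mx_unitmx sT.
set Dr := diag_mx r^T in Dru DrV *; set Ds := diag_mx s^T in Dsu DsV *.
have ct0 : 0 < c * t by rewrite mulr_gt0.
(* The unscaled factors have row sums [c * t] (by [Us]) and [c^-1] (by [sE]); the two normalising
   scalars multiply to [t^-1], the factor in the stochasticization. *)
exists ((c * t)^-1 *: (invmx Dr *m U *m Ds)), (c *: (invmx Ds *m V *m Dr)).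
have PE i j : ((c * t)^-1 *: (invmx Dr *m U *m Ds)) i j
    = (c * t)^-1 * ((r i 0)^-1 * (U i j * s j 0)).
  by rewrite mxE DrV mul_mx_diag mul_diag_mx !mxE !mulrA.
have QE i j : (c *: (invmx Ds *m V *m Dr)) i j
    = c * ((s i 0)^-1 * (V i j * r j 0)).
  by rewrite mxE DsV mul_mx_diag mul_diag_mx !mxE !mulrA.
split.
- split; first apply/mxOverP => i j.
    rewrite PE qualifE /= !mulr_ge0 ?invr_ge0 ?(ltW (r0 i)) ?(ltW (s0 j)) ?(ltW ct0)//.
    exact: (mxOverP U0).
  move=> i; under eq_bigr do rewrite PE.
  rewrite -!mulr_sumr; have /matrixP/(_ i 0) := Us; rewrite !mxE => ->.
  by rewrite [(r i 0)^-1 * _]mulrCA mulVf ?gt_eqF// mulr1 mulVf// gt_eqF.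
- split; first apply/mxOverP => i j.
    rewrite QE qualifE /= !mulr_ge0 ?invr_ge0 ?(ltW (r0 j)) ?(ltW (s0 i)) ?(ltW c0)//.
    exact: (mxOverP V0).
  move=> i; under eq_bigr do rewrite QE.
  rewrite -!mulr_sumr mulrCA; have /matrixP/(_ i 0) := sE; rewrite !mxE => <-.
  by rewrite mulVf// gt_eqF.
- rewrite -scalemxAl -scalemxAr scalerA invfM mulrAC mulVf ?gt_eqF// mul1r.
  by rewrite AE !mulmxA mulmxK.
- rewrite -scalemxAl -scalemxAr scalerA invfM mulrA divff ?gt_eqF// mul1r.
  by rewrite BE !mulmxA mulmxK.
Qed.
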